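(* Suppose $\varsigma_*<\infty$ and that the utility condition, the bounded-profit condition, the Leibniz condition, the boundedness condition, the $\Omega$-product condition and the vanishing condition (all spelled out in the context) hold. Let $\mathcal{J}'\subsetneq\{1,\dots,J\}$ be a proper subset with $J'=|\mathcal{J}'|$ elements, and let $\mathbf{p}^*_{\mathcal{J}'}=(p_j^* )_{j\in\mathcal{J}'}\in[0,\varsigma_*]^{J'}$ be any solution of the sub-variational inequality $$\sum_{j\in\mathcal{J}'}(D_j\hat\pi_{f(j)})(\mathbf{p}^*_{\mathcal{J}'})(p_j^*-q_j)\ge0\quad\text{for all }(q_j)_{j\in\mathcal{J}'}\in[0,\varsigma_*]^{J'},$$ where the profits are those of the market in which only the products in $\mathcal{J}'$ are offered. Define $\mathbf{p}\in[0,\varsigma_*]^J$ by $p_j=p_j^*$ for all $j\in\mathcal{J}'$ and $p_k=\varsigma_*$ for all $k\notin\mathcal{J}'$. Then $\mathbf{p}$ solves the full variational inequality: $(\tilde\nabla\hat\pi)(\mathbf{p})^\top(\mathbf{p}-\mathbf{q})\ge0$ for all $\mathbf{q}\in[0,\varsigma_*]^J$.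
   Context: Products are indexed by $\{1,\dots,J\}$, partitioned into nonempty sets $\mathcal{J}_1,\dots,\mathcal{J}_F$ (the products of firms $1,\dots,F$); $f(j)$ is the firm with $j\in\mathcal{J}_{f(j)}$. $\mathcal{P}=[0,\infty)$; unit costs are $\mathbf{c}\in\mathcal{P}^J$. $(\mathcal{T},\mu)$ is a probability space of consumer characteristics $\theta$ (all functions of $\theta$ are measurable), and $\vartheta:\mathcal{T}\to\mathbb{R}$. Product $j$ has utility $u_j:\mathcal{T}\times\mathcal{P}\to[-\infty,\infty)$. Utility condition: $u_j(\theta,p)=w_j(\theta,p)+v_j(\theta)$ with $v_j:\mathcal{T}\to\mathbb{R}$, and there is $\varsigma:\mathcal{T}\to(0,\infty]$ such that for all $j$ and $\mu$-a.e. $\theta$: (a) $w_j(\theta,\cdot)$ is continuously differentiable, strictly decreasing and finite on $(0,\varsigma(\theta))$; (b) $w_j(\theta,p)=-\infty$ for all $p\ge\varsigma(\theta)$; (c) $w_j(\theta,p)\downarrow-\infty$ as $p\uparrow\varsigma(\theta)$. $Dw_j$ is the derivative of $w_j$ in price. Put $\varsigma_*=\operatorname{ess\,sup}_\mu\varsigma$. Logit and mixed logit probabilities (with $e^{-\infty}=0$): $P_j^L(\theta,\mathbf{p})=e^{u_j(\theta,p_j)}/(e^{\vartheta(\theta)}+\sum_{k=1}^J e^{u_k(\theta,p_k)})$, $P_j(\mathbf{p})=\int P_j^L(\theta,\mathbf{p})\,d\mu(\theta)$, $\mathbf{P}=(P_1,\dots,P_J)$. Let $\mathcal{L}(p)=\{\theta:\varsigma(\theta)>p\}$,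 $\lambda_j(\mathbf{p})=\int_{\mathcal{L}(p_j)}(Dw_j)(\theta,p_j)P_j^L(\theta,\mathbf{p})\,d\mu$, $\gamma_{j,k}(\mathbf{p})=\int_{\mathcal{L}(p_j)\cap\mathcal{L}(p_k)}P_j^L(\theta,\mathbf{p})P_k^L(\theta,\mathbf{p})(Dw_k)(\theta,p_k)\,d\mu$. $\Lambda=\operatorname{diag}(\lambda_j)$; $\tilde\Gamma$ has entries $\gamma_{j,k}$ if $f(j)=f(k)$ and $0$ otherwise; $\tilde\Omega(\mathbf{p})=\Lambda(\mathbf{p})^{-1}\tilde\Gamma(\mathbf{p})^\top$. Bounded-profit condition: for every $j$ there are $r_j:\mathcal{T}\to(1,\infty)$ and $\bar p_j:\mathcal{T}\to\mathcal{P}$ with $\sup\{p\,\mu(\{\bar p_j>p\}):p\in(0,\varsigma_* )\}<\infty$ and, for $\mu$-a.e. $\theta$, $u_j(\theta,p)\le -r_j(\theta)\log p+\vartheta(\theta)$ for all $p\ge\bar p_j(\theta)$. Leibniz condition: for every $k$, with $\psi_k(\theta,p)=|(Dw_k)(\theta,p)|\,e^{u_k(\theta,p)}/(e^{\vartheta(\theta)}+e^{u_k(\theta,p)})$ if $p<\varsigma(\theta)$ and $\psi_k(\theta,p)=0$ if $p\ge\varsigma(\theta)$: $\psi_k(\theta,\cdot)$ is continuous on $(0,\varsigma_* )$ for $\mu$-a.e. $\theta$, and for every $p\in(0,\varsigma_* )$ there is a $\mu$-integrable $\varphi\ge0$ with $\psi_k(\theta,p')\le\varphi(\theta)$ for all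 $p'$ in some neighborhood of $p$. Boundedness condition: $\sup\{\|\Lambda(\mathbf{p})^{-1}\mathbf{P}(\mathbf{p})\|_\infty:\mathbf{p}\in(0,\varsigma_* )^J\}<\infty$ and $\sup\{\|\tilde\Omega(\mathbf{p})\|_\infty:\mathbf{p}\in(0,\varsigma_* )^J\}<1$. $\Omega$-product condition: $\sup\{\|\tilde\Omega(\mathbf{p})(\mathbf{p}-\mathbf{c})\|_\infty:\mathbf{p}\in(0,\varsigma_* )^J\}<\infty$. Vanishing condition: for every $k$, $p\,\psi_k(\theta,p)\to0$ as $p\uparrow\varsigma(\theta)$ for $\mu$-a.e. $\theta$, and there are $M<\infty$, $\bar p_k\in[0,\varsigma_* )$ with $p\int\psi_k(\theta,p)\,d\mu(\theta)\le M$ for all $p\in(\bar p_k,\varsigma_* )$. Profits: $\hat\pi_f(\mathbf{p})=\sum_{j\in\mathcal{J}_f}P_j(\mathbf{p})(p_j-c_j)$; $D_k$ is the partial derivative in $p_k$. The combined gradient $(\tilde\nabla\hat\pi)(\mathbf{p})\in\mathbb{R}^J$ has components $(D_k\hat\pi_{f(k)})(\mathbf{p})$. For the market offering only the products in $\mathcal{J}'$, choice probabilities and profits are defined by the same formulas with $\{1,\dots,J\}$ replaced by $\mathcal{J}'$ and $\mathcal{J}_f$ by $\mathcal{J}_f\cap\mathcal{J}'$.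
   Formalization: At a price equal to ς_*, the partial derivative of profit is taken as the right derivative, because the stated conditions do not guarantee that the two-sided derivative exists there; the two agree whenever the latter exists. *)

(* Defs.v *)
From HB Require Import structures.
From mathcomp Require Import all_boot all_order all_algebra.
From mathcomp Require Import all_classical all_reals all_analysis.
From mathcomp Require Import measurable_realfun ess_sup_inf.
Import Order.TTheory GRing.Theory Num.Theory.
Import numFieldNormedType.Exports.

Set Implicit Arguments.
Unset Strict Implicit.
Unset Printing Implicit Defensive.

Local Open Scope classical_set_scope.
Local Open Scope ring_scope.

(* Prices are reals; the price set [0, oo) is imposed where prices are
   quantified, and utilities at negative prices are never used.  Utilities take
   values in \bar R and are required to be < +oo; e^(-oo) = 0 is expeR. *)

(* The filter of reals increasing to s : \bar R (s = -oo never occurs). *)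
Definition up_to {R : realType} (s : \bar R) : set_system R :=
  match s with
  | r%:E => r^'-
  | +oo%E => +oo
  | -oo%E => -oo
  end.

(* Operator norm induced by the max norm; on columns it is the max norm. *)
Definition norm_oo {R : realType} {m n : nat} (A : 'M[R]_(m, n)) : R :=
  \big[Num.max/0]_(i < m) \sum_(j < n) `|A i j|.

Section Market.
Context {d : measure_display} {T : measurableType d} {R : realType}.
Variable mu : probability T R.
(* I is the set of offered products, so that the market restricted to a subset
   of products is an instance of the same definitions. *)
Context {I : finType} {F : nat}.
Variables (firm : I -> 'I_F) (cost : I -> R).
Variables (vartheta : T -> R) (u : I -> T -> R -> \bar R).

Definition logit (p : I -> R) (j : I) (t : T) : R :=
  fine (expeR (u j t (p j))) /
  (expR (vartheta t) + \sum_k fine (expeR (u k t (p k)))).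

Definition choice_prob (p : I -> R) (j : I) : R :=
  Rintegral mu setT (logit p j).

Definition profit (p : I -> R) (f : 'I_F) : R :=
  \sum_(j | firm j == f) choice_prob p j * (p j - cost j).

(* s stands for varsigma_*.  The derivative in a price x is the limit of the
   difference quotient over the price set [0, oo); it is two-sided for
   0 < x < s and one-sided at x = 0.  At x = s it is the right derivative: the
   hypotheses do not make profits differentiable at s from the left, and the
   right derivative is the partial derivative whenever the latter exists. *)
Definition price_dnbhs (s : \bar R) (x : R) : set_system R :=
  if (x%:E < s)%E then within [set y | 0 <= y] x^' else x^'+.

Definition set_price (p : I -> R) (k : I) (y : R) : I -> R :=
  fun j => if j == k then y else p j.

Definition is_combined_gradient (s : \bar R) (p g : I -> R) : Prop :=
  forall k,
    (profit (set_price p k y) (firm k) - profit p (firm k)) / (y - p k)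
      @[y --> price_dnbhs s (p k)] --> g k.

Definition price_box (s : \bar R) : set (I -> R) :=
  [set p | forall j, 0 <= p j /\ ((p j)%:E <= s)%E].

Definition solves_vi (s : \bar R) (p : I -> R) : Prop :=
  price_box s p /\
  exists2 g, is_combined_gradient s p g &
    forall q, price_box s q -> 0 <= \sum_j g j * (p j - q j).

End Market.

Section Conditions.
Context {d : measure_display} {T : measurableType d} {R : realType}.
Variable mu : probability T R.
Context {J F : nat}.
Variables (firm : 'I_J -> 'I_F) (cost : 'I_J -> R).
Variables (vartheta : T -> R) (u w : 'I_J -> T -> R -> \bar R).
Variables (v : 'I_J -> T -> R) (varsigma : T -> \bar R).

Definition varsigma_star : \bar R := ess_sup mu varsigma.

Definition below_star : set R := [set p | 0 < p /\ (p%:E < varsigma_star)%E].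

Definition open_box : set ('I_J -> R) := [set p | forall j, below_star (p j)].

Definition Dw (j : 'I_J) (t : T) (p : R) : R :=
  derive1 (fun q => fine (w j t q)) p.

Definition can_buy (p : R) : set T := [set t | (p%:E < varsigma t)%E].

Definition utility_condition : Prop :=
  [/\ (forall j t (p : R), 0 <= p ->
         (u j t p < +oo)%E /\ u j t p = (w j t p + (v j t)%:E)%E),
      (forall t, (0 < varsigma t)%E),
      [/\ measurable_fun setT vartheta, measurable_fun setT varsigma,
          (forall j, measurable_fun setT (v j)),
          (forall j (p : R), 0 <= p ->
             measurable_fun setT (fun t => u j t p) /\
             measurable_fun setT (fun t => w j t p)) &
          (forall j (p : R), 0 < p ->
             measurable_fun (can_buy p) (fun t => Dw j t p))] &
      forall j, {ae mu, forall t,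
        [/\ (forall p : R, 0 < p -> (p%:E < varsigma t)%E ->
               [/\ w j t p \is a fin_num,
                   derivable (fun q => fine (w j t q)) p 1 &
                   {for p, continuous (Dw j t)}]),
            (forall p q : R, 0 < p -> p < q -> (q%:E < varsigma t)%E ->
               (w j t q < w j t p)%E),
            (forall p : R, 0 <= p -> (varsigma t <= p%:E)%E ->
               w j t p = -oo%E) &
            w j t p @[p --> up_to (varsigma t)] --> -oo%E]}].

Definition bounded_profit_condition : Prop :=
  forall j, exists r pbar : T -> R,
    [/\ measurable_fun setT r /\ measurable_fun setT pbar,
        forall t, 1 < r t /\ 0 <= pbar t,
        (ereal_sup [set (p%:E * mu [set t | (p < pbar t)%R])%E
                   | p in below_star] < +oo)%E &
        {ae mu, forall t, forall p, pbar t <= p ->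
          (u j t p <= - (r t)%:E * lne p%:E + (vartheta t)%:E)%E}].

Definition psi (k : 'I_J) (t : T) (p : R) : R :=
  if (p%:E < varsigma t)%E then
    `|Dw k t p| * fine (expeR (u k t p)) /
    (expR (vartheta t) + fine (expeR (u k t p)))
  else 0.

Definition leibniz_condition : Prop :=
  forall k,
    {ae mu, forall t, forall p, below_star p -> {for p, continuous (psi k t)}} /\
    forall p, below_star p ->
      exists phi : T -> R,
        [/\ forall t, 0 <= phi t,
            mu.-integrable setT (EFin \o phi) &
            exists2 U, nbhs p U &
              {ae mu, forall t, forall p', U p' -> psi k t p' <= phi t}].

Definition lambda (p : 'I_J -> R) (j : 'I_J) : R :=
  Rintegral mu (can_buy (p j))
    (fun t => Dw j t (p j) * logit vartheta u p j t).

Definition gamma (p : 'I_J -> R) (j k : 'I_J) : R :=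
  Rintegral mu (can_buy (p j) `&` can_buy (p k))
    (fun t => logit vartheta u p j t * logit vartheta u p k t * Dw k t (p k)).

Definition Lambda (p : 'I_J -> R) : 'M[R]_J :=
  diag_mx (\row_j lambda p j).

Definition tGamma (p : 'I_J -> R) : 'M[R]_J :=
  \matrix_(j, k) (if firm j == firm k then gamma p j k else 0).

Definition tOmega (p : 'I_J -> R) : 'M[R]_J :=
  invmx (Lambda p) *m (tGamma p)^T.

Definition choice_probs (p : 'I_J -> R) : 'cV[R]_J :=
  \col_j choice_prob mu vartheta u p j.

(* invmx is the inverse only on unitmx, so invertibility, implicit in the
   notation Lambda^-1, is stated. *)
Definition boundedness_condition : Prop :=
  [/\ forall p, open_box p -> Lambda p \in unitmx,
      (ereal_sup [set (norm_oo (invmx (Lambda p) *m choice_probs p))%:E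
                 | p in open_box] < +oo)%E &
      (ereal_sup [set (norm_oo (tOmega p))%:E | p in open_box] < 1)%E].

Definition Omega_product_condition : Prop :=
  (ereal_sup [set (norm_oo (tOmega p *m \col_j (p j - cost j)))%:E
             | p in open_box] < +oo)%E.

Definition vanishing_condition : Prop :=
  forall k,
    {ae mu, forall t, p * psi k t p @[p --> up_to (varsigma t)] --> (0 : R)} /\
    exists M pbar : R,
      [/\ 0 <= pbar, (pbar%:E < varsigma_star)%E &
          forall p, pbar < p -> (p%:E < varsigma_star)%E ->
            (p%:E * \int[mu]_t (psi k t p)%:E <= M%:E)%E].

End Conditions.

(* Main.v *)
Require Import Defs.
From HB Require Import structures.
From mathcomp Require Import all_boot all_order all_algebra.
From mathcomp Require Import all_classical all_reals all_analysis.
From mathcomp Require Import measurable_realfun ess_sup_inf.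
Import Order.TTheory GRing.Theory Num.Theory.
Import numFieldNormedType.Exports.

Set Implicit Arguments.
Unset Strict Implicit.
Unset Printing Implicit Defensive.

Local Open Scope ring_scope.

(* A product priced at varsigma_* or above is bought by almost nobody, so it has
   no effect on the choice probabilities and profits of the other products.
   Hence the gradient in the prices of the sub-market is that of the sub-market
   alone, while raising the price of an excluded product above varsigma_*
   changes nothing: the remaining components of the combined gradient vanish,
   and the full variational inequality reduces to the sub-variational one. *)

Lemma fine_expeR_ge0 (R : realType) (x : \bar R) : 0 <= fine (expeR x).
Proof. by case: x => //= r; exact: expR_ge0. Qed.

Lemma measurable_fine_expeR (R : realType) (d : measure_display)
    (T : measurableType d) (f : T -> \bar R) :
  measurable_fun [set: T]%classic f ->
  measurable_fun [set: T]%classic (fun t => fine (expeR (f t))).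
Proof.
move=> mf.
(* [fine] sends [+oo] to 0 and [expeR] sends [-oo] to 0, so both infinite values give 0 and a real
   exponential remains only in the finite case. *)
have -> : (fun t => fine (expeR (f t))) =
    (fun t => if f t == -oo%E then 0 else
              if f t == +oo%E then 0 else expR (fine (f t))).
  by apply/funext => t; case: (f t).
do 2! [apply: measurable_fun_ifT; [exact: measurable_fun_eqe | exact: measurable_cst |]].
apply: measurableT_comp; first exact: measurable_expR.
by apply: measurableT_comp => //; exact: fine_measurable.
Qed.

Section Submarket.
Context {d : measure_display} {T : measurableType d} {R : realType}.
Variable mu : probability T R.
Context {I : finType} {F : nat}.
Variables (firm : I -> 'I_F) (cost : I -> R).
Variables (vartheta : T -> R).
Hypothesis measurable_vartheta : measurable_fun [set: T]%classic vartheta.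

Lemma measurable_logit (K : finType) (u : K -> T -> R -> \bar R) (p : K -> R)
    (j : K) :
  (forall k, measurable_fun [set: T]%classic (fun t => u k t (p k))) ->
  measurable_fun [set: T]%classic (logit vartheta u p j).
Proof.
move=> mu_u; apply: measurable_funM; first exact: measurable_fine_expeR.
set D := fun t => expR (vartheta t) + \sum_k fine (expeR (u k t (p k))).
(* Inversion agrees with the power -1 on nonnegative reals, so measurability of real powers yields
   that of the quotient. *)
have -> : (fun t => (D t)^-1) = (fun x : R => x `^ (-1)) \o D.
  apply/funext => t /=; rewrite powR_inv1//.
  by rewrite addr_ge0 ?expR_ge0// sumr_ge0// => k _; exact: fine_expeR_ge0.
apply: measurableT_comp; first exact: measurable_powR.
apply: measurable_funD; first by apply: measurableT_comp.
by apply: measurable_sum => k; exact: measurable_fine_expeR.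
Qed.

Variables (u : I -> T -> R -> \bar R) (p : I -> R) (A : {set I}).
Hypothesis measurable_utility :
  forall k, measurable_fun [set: T]%classic (fun t => u k t (p k)).
Hypothesis unbought :
  forall k, k \notin A -> {ae mu, forall t, u k t (p k) = -oo%E}.

Let sub_t := {j : I | j \in A}.

(** Merges the exceptional null sets of the finitely many excluded products into one, as the logit
    denominator involves all of them at once. *)
Let unbought_all :
  {ae mu, forall t, forall k, k \notin A -> u k t (p k) = -oo%E}.
Proof.
apply: filter_forall => k; case: (boolP (k \in A)) => [kA|kA].
  by apply: filterE.
by apply: filterS (unbought kA) => t.
Qed.

Lemma choice_prob_unbought k : k \notin A ->
  choice_prob mu vartheta u p k = 0.
Proof.
move=> kA; rewrite /choice_prob /Rintegral.
rewrite (ae_eq_integral (cst 0%E)) ?integral0//.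
  by apply/measurable_EFinP; exact: measurable_logit.
apply: filterS (unbought kA) => t ut _.
by rewrite /logit ut/= mul0r.
Qed.

(** Off a null set each excluded product adds e^(-oo) = 0 to the logit denominator, so the two
    integrands agree almost everywhere. *)
Lemma choice_prob_submarket (j : sub_t) :
  choice_prob mu vartheta u p (val j) =
  choice_prob mu vartheta (fun j : sub_t => u (val j))
    (fun j : sub_t => p (val j)) j.
Proof.
rewrite /choice_prob /Rintegral; congr fine; apply: ae_eq_integral => //.
- by apply/measurable_EFinP; exact: measurable_logit.
- by apply/measurable_EFinP; apply: measurable_logit => k.
apply: filterS unbought_all => t ut _; congr EFin; congr (_ / (_ + _)).
rewrite (bigID (mem A))/= [X in _ + X]big1 ?addr0 => [|k kA]; last by rewrite ut.
by rewrite big_sub.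
Qed.

Lemma profit_submarket (f : 'I_F) :
  profit mu firm cost vartheta u p f =
  profit mu (fun j : sub_t => firm (val j)) (fun j : sub_t => cost (val j))
    vartheta (fun j : sub_t => u (val j)) (fun j : sub_t => p (val j)) f.
Proof.
rewrite /profit (bigID (mem A))/= [X in _ + X]big1 ?addr0; last first.
  by move=> k /andP[_ kA]; rewrite choice_prob_unbought// mul0r.
rewrite (eq_bigl (fun j => (j \in A) && (firm j == f))); last first.
  by move=> j; rewrite andbC.
rewrite big_sub_cond; apply: eq_bigr => j _.
by rewrite choice_prob_submarket.
Qed.

End Submarket.

Section PriceFilter.
Context {R : realType}.
Variables (s : \bar R) (x : R).

Global Instance price_dnbhs_filter : Filter (price_dnbhs s x).
Proof. by rewrite /price_dnbhs; case: ifP => _; exact _. Qed.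

(** Keeps perturbed prices in the range where the utility condition speaks about utilities. *)
Lemma price_dnbhs_ge0 : 0 <= x -> \forall y \near price_dnbhs s x, 0 <= y.
Proof.
rewrite /price_dnbhs => x0; case: ifP => _; first exact: withinT.
by apply: filterS (nbhs_right_gt x) => y /ltW; exact: le_trans.
Qed.

Lemma price_dnbhs_top : x%:E = s -> price_dnbhs s x = x^'+%classic.
Proof. by move=> <-; rewrite /price_dnbhs ltxx. Qed.

End PriceFilter.

Theorem proposition5p2 (d : measure_display) (T : measurableType d)
    (R : realType) (mu : probability T R) (J F : nat)
    (firm : 'I_J -> 'I_F) (cost : 'I_J -> R)
    (vartheta : T -> R) (u w : 'I_J -> T -> R -> \bar R)
    (v : 'I_J -> T -> R) (varsigma : T -> \bar R)
    (firm_nonempty : forall f : 'I_F, exists j : 'I_J, firm j = f)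
    (cost_ge0 : forall j : 'I_J, 0 <= cost j)
    (finite_star : (varsigma_star mu varsigma < +oo)%E)
    (utility : utility_condition mu vartheta u w v varsigma)
    (bounded_profit : bounded_profit_condition mu vartheta u varsigma)
    (leibniz : leibniz_condition mu vartheta u w varsigma)
    (boundedness : boundedness_condition mu firm vartheta u w varsigma)
    (Omega_product :
       Omega_product_condition mu firm cost vartheta u w varsigma)
    (vanishing : vanishing_condition mu vartheta u w varsigma)
    (A : {set 'I_J}) (A_proper : A \proper [set: 'I_J]%SET)
    (pstar : {j : 'I_J | j \in A} -> R)
    (pstar_solves :
       solves_vi mu (fun j : {j : 'I_J | j \in A} => firm (val j))
         (fun j : {j : 'I_J | j \in A} => cost (val j))
         vartheta (fun j : {j : 'I_J | j \in A} => u (val j))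
         (varsigma_star mu varsigma) pstar)
    (p : 'I_J -> R)
    (p_in : forall j : {j : 'I_J | j \in A}, p (val j) = pstar j)
    (p_out : forall k : 'I_J, k \notin A ->
       (p k)%:E = varsigma_star mu varsigma) :
  solves_vi mu firm cost vartheta u (varsigma_star mu varsigma) p.
Proof.
have [u_w varsigma_gt0 [mvartheta _ _ mu_w _] w_above] := utility.
set s := varsigma_star mu varsigma in p_in p_out pstar_solves *.
(* This places the excluded prices, all equal to [s], in the price box. *)
have s_ge0 : (0 <= s)%E.
  have mu_gt0 : (0 < mu [set: T]%classic)%E by rewrite probability_setT.
  by apply: ess_sup_gee => //; apply: filterE => t; exact: ltW.
(* Almost every [t] has [varsigma t <= s <= x], where [w] is [-oo]; adding the finite [v] keeps it
   so. *)
have unbought k (x : R) : 0 <= x -> (s <= x%:E)%E ->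
    {ae mu, forall t, u k t x = -oo%E}.
  move=> x0 sx; have vs := ess_sup_ge mu varsigma.
  apply: filterS2 vs (w_above k) => t ts [_ _ wNy _].
  by have [_ ->] := u_w k t _ x0; rewrite wNy//; exact: le_trans ts sx.
(* Stated for general [q], since it serves both at [p] and at [p] with one price perturbed. *)
have profit_sub (q : 'I_J -> R) f : (forall k, 0 <= q k) ->
    (forall k, k \notin A -> (s <= (q k)%:E)%E) ->
    profit mu firm cost vartheta u q f =
    profit mu (fun j : {j | j \in A} => firm (val j))
      (fun j : {j | j \in A} => cost (val j))
      vartheta (fun j : {j | j \in A} => u (val j)) (fun j => q (val j)) f.
  move=> q0 qs; apply: profit_submarket => // [k|k kA].
    exact: (mu_w k _ (q0 k)).1.
  by apply: unbought => //; exact: qs.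
case: pstar_solves => box_pstar [g grad_g vi_g].
have box_p : price_box s p.
  move=> k; have [kA|kA] := boolP (k \in A).
    by have := box_pstar (exist _ k kA); rewrite -p_in.
  by rewrite -lee_fin (p_out _ kA).
have p_s k : k \notin A -> (s <= (p k)%:E)%E by move=> /p_out ->.
have p_sub : (fun j : {j | j \in A} => p (val j)) = pstar.
  exact/funext.
split => //.
(* The candidate gradient extends the sub-market gradient by 0 outside [A]. *)
pose g' k := if insub k is Some j then g j else 0.
have g'_val j : g' (val j) = g j by rewrite /g' valK.
have g'_out k : k \notin A -> g' k = 0 by move=> kA; rewrite /g' insubN.
exists g' => [k|q box_q].
- have [kA|kA] := boolP (k \in A).
  + pose j : {j | j \in A} := exist _ k kA.
    rewrite -[k]/(val j) g'_val p_in.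
    apply: cvg_trans (grad_g j); apply: near_eq_cvg.
    have pj0 : 0 <= pstar j by case: (box_pstar j).
    apply: filterS (price_dnbhs_ge0 s pj0) => y y0.
    rewrite !profit_sub ?p_sub//.
    * congr ((profit _ _ _ _ _ _ _ - _) / _); apply/funext => i.
      by rewrite /set_price val_eqE p_in.
    * by move=> i; case: (box_p i).
    * by move=> i; rewrite /set_price; case: ifP => // _; case: (box_p i).
    (* The perturbed coordinate lies in [A], so an excluded price is never moved. *)
    * move=> i iA; rewrite /set_price; case: eqP => [ij|_]; last exact: p_s.
      by move: iA; rewrite ij (valP j).
  + rewrite g'_out// price_dnbhs_top; last exact: p_out.
    have pk0 : 0 <= p k by case: (box_p k).
    (* For [y] above [p k = s] product [k] stays unbought: both profits reduce to the same
       sub-market profit and the quotient is constantly 0. *)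
    apply: cvg_near_cst; apply: filterS (nbhs_right_gt (p k)) => y py.
    rewrite !profit_sub//.
    * have -> : (fun j : {j | j \in A} => set_price p k y (val j)) =
          fun j => p (val j).
        apply/funext => i; rewrite /set_price; case: eqP => // ik.
        by move: kA; rewrite -ik (valP i).
      by rewrite subrr mul0r.
    * by move=> i; case: (box_p i).
    * move=> i; rewrite /set_price; case: ifP => _; last by case: (box_p i).
      exact: le_trans (ltW py).
    * move=> i iA; rewrite /set_price; case: ifP => _; last exact: p_s.
      by apply: le_trans (p_s _ kA) _; rewrite lee_fin ltW.
- rewrite (bigID (mem A))/= [X in _ + X]big1 ?addr0; last first.
    by move=> k kA; rewrite g'_out// mul0r.
  rewrite big_sub; under eq_bigr do rewrite g'_val p_in.
  (* Only the terms in [A] survive, and the restriction of [q] to [A] is an admissible test point of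
     the sub-market inequality. *)
  by apply: (vi_g (fun j => q (val j))) => j; exact: box_q.
Qed.
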